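(* For $|t|<1$ and $|q|<1$: (a) $\displaystyle \frac{1}{(t)_{\infty}} =1+ \sum_{n=1}^{\infty}\frac{tq^{n-1}}{(tq^{n-1})_{\infty}}$; (b) $\displaystyle \sum_{n=1}^{\infty}\frac{q^n}{(q)_{n-1}(1-q^n)^2} = \sum_{n=1}^{\infty}\frac{nq^{n}}{(q^n)_{\infty}}$; (c) $\displaystyle \sum_{n=1}^{\infty}\frac{q^n}{(q)_{n}(1+q^n)} = \sum_{n=1}^{\infty}\frac{q^{2n-1}}{(q^{2n-1})_{\infty}}$; (d) $\displaystyle \sum_{n=1}^{\infty}\frac{(-1)^{n+1}q^n}{(q)_{n}(1-q^n)} = \sum_{n=1}^{\infty}\frac{nq^{n}}{(-q^n)_{\infty}}$; (e) $\displaystyle \sum_{n=1}^{\infty}\frac{(-1)^{n+1}q^n}{(q)_{n}(1+q^n)} = \sum_{n=1}^{\infty}\frac{q^{2n-1}}{(-q^{2n-1})_{\infty}}$.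
   Context: For $x\in\mathbb{C}$ and $n\ge 0$, $(x)_n=(x;q)_n=\prod_{j=0}^{n-1}(1-xq^j)$ (with $(x)_0=1$) and $(x)_\infty=\prod_{j=0}^{\infty}(1-xq^j)$. *)

(* Defs.v *)
From Stdlib Require Import Reals.
From Coquelicot Require Export Coquelicot.
Open Scope C_scope.

(** [qpoch q x n] is (x;q)_n. *)
Fixpoint qpoch (q x : C) (n : nat) : C :=
  match n with
  | O => 1
  | S m => qpoch q x m * (1 - x * q ^ m)
  end.

(** [qpoch_inf q x] is (x;q)_oo. The operator [lim] is total: it returns the
    limit whenever there is one (see [qpoch_inf_unique]), which is the case for
    every [x] as soon as [Cmod q < 1]. *)
Definition qpoch_inf (q x : C) : C :=
  @lim C_CompleteNormedModule (filtermap (qpoch q x) eventually).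

(** The series [a 1 + a 2 + ...] converges to [s]; [a 0] is ignored. *)
Definition is_series_from_1 (a : nat -> C) (s : C) : Prop :=
  @is_series C_AbsRing C_NormedModule (fun k => a (S k)) s.

Lemma qpoch_inf_unique (q x l : C) :
  filterlim (qpoch q x) eventually (@locally C_UniformSpace l) ->
  qpoch_inf q x = l.
Proof.
intros H.
assert (Hc : cauchy (T := C_CompleteNormedModule) (filtermap (qpoch q x) eventually)).
{ intros eps. exists l. apply H. exists eps. intros y Hy; exact Hy. }
apply (filterlim_locally_unique (K := C_AbsRing) (V := C_NormedModule)
         (F := eventually) (qpoch q x)); [ | exact H].
intros P [eps HP].
generalize (complete_cauchy (T := C_CompleteNormedModule) _ _ Hc eps).
apply filter_imp. exact HP.
Qed.

(* Main.v *)
(** By Euler's identity [1/(x)_oo = sum_m x^m/(q)_m] the right-hand sides of (b)-(e)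
    become double series in [q^(n(m+1))], weighted by [n] or restricted to odd [n]; summing over
    [n] first gives the left-hand sides. The interchange is licit because the
    terms are dominated by a product [f n * g m] of summable sequences.
    Euler's identity itself follows from the functional equation
    [(1-x) F(x) = F(xq)] of the series [F]: iterated, it reads
    [(x;q)_n F(x) = F(xq^n)], which tends to [F(0) = 1]. Part (a) telescopes,
    since [t/(t)_oo = 1/(t)_oo - 1/(tq)_oo]. *)

Require Import Defs.
From Stdlib Require Import Reals Lra Lia.
From Coquelicot Require Import Coquelicot.
Open Scope C_scope.

(** * Complex series: limits and termwise operations *)

Local Notation Cseries := (@is_series C_AbsRing C_NormedModule).

(** Reduces complex limits to real null sequences, so that squeezing and limit arithmetic on the
    reals apply. *)
Lemma filterlim_C_iff (u : nat -> C) (l : C) :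
  filterlim u eventually (@locally C_UniformSpace l) <->
  is_lim_seq (fun n => Cmod (u n - l)) 0.
Proof.
rewrite (filterlim_locally_ball_norm (K := C_AbsRing) (U := C_NormedModule) u l).
rewrite <- is_lim_seq_spec.
split; intros H eps; generalize (H eps); apply filter_imp; intros n Hn.
- rewrite Rminus_0_r, Rabs_pos_eq by apply Cmod_ge_0. exact Hn.
- rewrite Rminus_0_r, Rabs_pos_eq in Hn by apply Cmod_ge_0. exact Hn.
Qed.

Lemma Cseries_unique (a : nat -> C) (s s' : C) :
  Cseries a s -> Cseries a s' -> s = s'.
Proof.
exact (filterlim_locally_unique (K := C_AbsRing) (V := C_NormedModule)
         (F := eventually) (sum_n a) s s').
Qed.

(** Feeding a known series as the third premise leaves two algebraic goals, one for the terms and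
    one for the value. *)
Lemma Cseries_ext_eq (a b : nat -> C) (s s' : C) :
  (forall n, a n = b n) -> s = s' -> Cseries a s -> Cseries b s'.
Proof. intros H <-. now apply is_series_ext. Qed.

Lemma Cseries_scal (c : C) (a : nat -> C) (s : C) :
  Cseries a s -> Cseries (fun n => c * a n) (c * s).
Proof. exact (is_series_scal_l (K := C_AbsRing) (V := C_NormedModule) c a s). Qed.

Lemma Cseries_plus (a b : nat -> C) (s s' : C) :
  Cseries a s -> Cseries b s' -> Cseries (fun n => a n + b n) (s + s').
Proof. exact (is_series_plus (K := C_AbsRing) (V := C_NormedModule) a b s s'). Qed.

Lemma Cseries_minus (a b : nat -> C) (s s' : C) :
  Cseries a s -> Cseries b s' -> Cseries (fun n => a n - b n) (s - s').
Proof. exact (is_series_minus (K := C_AbsRing) (V := C_NormedModule) a b s s'). Qed.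

Lemma Cseries_shift (a : nat -> C) (s : C) :
  Cseries a s -> Cseries (fun n => a (S n)) (s - a O).
Proof.
intros H. apply (is_series_incr_1 (K := C_AbsRing) (V := C_NormedModule)).
apply Cseries_ext_eq with (3 := H); [reflexivity|].
change (s = s - a O + a O). ring.
Qed.

Lemma Cseries_unshift (a : nat -> C) (s : C) :
  Cseries (fun n => a (S n)) s -> Cseries a (s + a O).
Proof.
intros H. apply (is_series_decr_1 (K := C_AbsRing) (V := C_NormedModule)).
apply Cseries_ext_eq with (3 := H); [reflexivity|].
change (s = s + a O - a O). ring.
Qed.

Lemma Csum_n_S (a : nat -> C) (n : nat) :
  @sum_n C_AbelianMonoid a (S n) = @sum_n C_AbelianMonoid a n + a (S n).
Proof. now rewrite sum_Sn. Qed.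

Lemma Cseries_sum_n (u : nat -> nat -> C) (A : nat -> C) (N : nat) :
  (forall n, Cseries (u n) (A n)) ->
  Cseries (fun m => @sum_n C_AbelianMonoid (fun n => u n m) N)
    (@sum_n C_AbelianMonoid A N).
Proof.
intros H. induction N as [|N IH].
- apply Cseries_ext_eq with (3 := H O).
  + intros m. now rewrite sum_O.
  + now rewrite sum_O.
- apply Cseries_ext_eq with (3 := Cseries_plus _ _ _ _ IH (H (S N))).
  + intros m. now rewrite Csum_n_S.
  + now rewrite Csum_n_S.
Qed.

(** * Dominated series and interchange of summation *)

Lemma Cex_series_le (a : nat -> C) (b : nat -> R) :
  (forall n, (Cmod (a n) <= b n)%R) -> ex_series b -> exists s, Cseries a s.
Proof.
exact (ex_series_le (K := C_AbsRing) (V := C_CompleteNormedModule) a b).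
Qed.

(** [Cmod s] is at most the distance from [s] to a partial sum plus the partial sum of [b]; the
    distance tends to 0. *)
Lemma Cmod_series_le (a : nat -> C) (b : nat -> R) (s : C) (l : R) :
  (forall n, (Cmod (a n) <= b n)%R) -> Cseries a s -> is_series b l ->
  (Cmod s <= l)%R.
Proof.
intros Hab Ha Hb.
assert (Hl := proj1 (filterlim_C_iff _ _) Ha).
assert (H : is_lim_seq
  (fun n => (Cmod (@sum_n C_AbelianMonoid a n - s) + sum_n b n)%R) l).
{ replace l with (0 + l)%R by ring. apply is_lim_seq_plus'; assumption. }
apply (is_lim_seq_le (fun _ => Cmod s) _ (Cmod s) l) with (3 := H).
2: apply is_lim_seq_const.
intros n.
assert (H1 : (Cmod (@sum_n C_AbelianMonoid a n) <= sum_n b n)%R).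
{ refine (Rle_trans _ _ _ (norm_sum_n_m (K := C_AbsRing) (V := C_NormedModule) a 0 n) _).
  apply sum_n_m_le. exact Hab. }
replace s with (- (@sum_n C_AbelianMonoid a n - s) + @sum_n C_AbelianMonoid a n) at 1
  by ring.
refine (Rle_trans _ _ _ (Cmod_triangle _ _) _).
rewrite Cmod_opp. lra.
Qed.

(** With [F] and [G] the sums of [f] and [g], [B] is dominated by [F * g m] and so has a sum [s].
    The error of the partial sum of [A] up to [N] is the sum over [m] of the column tails beyond
    [N], hence at most [(F - sum_n f N) * G], which tends to 0. *)
Lemma Cseries_swap (u : nat -> nat -> C) (f g : nat -> R) (A B : nat -> C) :
  (forall n m, (Cmod (u n m) <= f n * g m)%R) ->
  ex_series f -> ex_series g ->
  (forall n, Cseries (u n) (A n)) ->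
  (forall m, Cseries (fun n => u n m) (B m)) ->
  exists s, Cseries A s /\ Cseries B s.
Proof.
intros Hu [F HF] [G HG] HA HB.
assert (HBle : forall m, (Cmod (B m) <= F * g m)%R).
{ intros m. apply (Cmod_series_le (fun n => u n m) (fun n => f n * g m)%R).
  - intros n. apply Hu.
  - apply HB.
  - now apply is_series_scal_r. }
destruct (Cex_series_le B (fun m => F * g m)%R HBle) as [s Hs].
{ exists (F * G)%R. now apply (is_series_scal_l F g G). }
exists s. split; [|exact Hs].
apply filterlim_C_iff.
(* The left side is the tail of column [m], the sum of [u n m] over [n > N], and the tail of [f]
   dominates it. *)
assert (Hrem : forall N m,
  (Cmod (B m - @sum_n C_AbelianMonoid (fun n => u n m) N)
    <= (F - sum_n f N) * g m)%R).
{ intros N m. revert N.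
  assert (HN : forall N, Cseries (fun k => u (k + S N)%nat m)
    (B m - @sum_n C_AbelianMonoid (fun n => u n m) N)).
  { induction N as [|N IH].
    - apply Cseries_ext_eq with (3 := Cseries_shift _ _ (HB m)).
      + intros k. now rewrite Nat.add_1_r.
      + now rewrite sum_O.
    - apply Cseries_ext_eq with (3 := Cseries_shift _ _ IH).
      + intros k. f_equal. lia.
      + rewrite Csum_n_S. cbn [Nat.add]. ring. }
  assert (HFN : forall N, is_series (fun k => f (k + S N)%nat) (F - sum_n f N)%R).
  { intros N.
    refine (is_series_ext _ _ _ _ (is_series_incr_n f (S N) _ _ _)).
    - intros k. f_equal. lia.
    - lia.
    - cbn [pred].
      change (is_series f (F - sum_n f N + sum_n f N)%R).
      assert (E : forall a b : R, (a - b + b)%R = a) by (intros; ring).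
      rewrite E. exact HF. }
  intros N.
  apply (Cmod_series_le (fun k => u (k + S N)%nat m)
          (fun k => f (k + S N)%nat * g m)%R).
  - intros n. apply Hu.
  - apply HN.
  - now apply is_series_scal_r. }
apply (is_lim_seq_le_le (fun _ => 0%R) _ (fun N => (F - sum_n f N) * G)%R).
- intros N. split; [apply Cmod_ge_0|].
  rewrite <- Cmod_opp.
  apply (Cmod_series_le
          (fun m => B m - @sum_n C_AbelianMonoid (fun n => u n m) N)
          (fun m => (F - sum_n f N) * g m)%R).
  + apply Hrem.
  + apply Cseries_ext_eq with
      (3 := Cseries_minus _ _ _ _ Hs (Cseries_sum_n u A N HA)).
    * reflexivity.
    * set (S := @sum_n C_AbelianMonoid A N).
      change (s - S = - (S - s)). ring.
  + now apply (is_series_scal_l (F - sum_n f N)%R g G).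
- apply is_lim_seq_const.
- replace (Finite 0) with (Finite ((F - F) * G)) by (f_equal; ring).
  apply is_lim_seq_mult'; [|apply is_lim_seq_const].
  apply is_lim_seq_minus'; [apply is_lim_seq_const|exact HF].
Qed.

(** * Ratio test and convergence of the dominating series *)

Lemma ex_series_ratio (a c : nat -> R) (k : R) :
  (k < 1)%R -> (forall n, (0 < a n)%R) -> (forall n, a (S n) = (a n * c n)%R) ->
  is_lim_seq c k -> ex_series a.
Proof.
intros Hk Ha Hc Hlim.
apply ex_series_Rabs, (ex_series_DAlembert a k Hk).
- intros n. apply Rgt_not_eq, Ha.
- replace k with (Rabs k).
  + apply (is_lim_seq_abs _ (Finite k)).
    apply is_lim_seq_ext with (2 := Hlim).
    intros n. rewrite Hc. field. apply Rgt_not_eq, Ha.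
  (* The ratios [c n] of positive terms are nonnegative, hence so is their limit [k]. *)
  + apply Rabs_pos_eq.
    apply (is_lim_seq_le (fun _ => 0%R) c 0 k) with (3 := Hlim).
    2: apply is_lim_seq_const.
    intros n. apply Rmult_le_reg_l with (a n); [apply Ha|].
    rewrite <- Hc, Rmult_0_r. apply Rlt_le, Ha.
Qed.

Lemma one_minus_neq0 (y : C) : (Cmod y < 1)%R -> 1 - y <> 0.
Proof.
intros H E. assert (y = 1) by (replace y with (1 - (1 - y)) by ring; rewrite E; ring).
subst y. rewrite Cmod_1 in H. lra.
Qed.

Lemma one_plus_neq0 (y : C) : (Cmod y < 1)%R -> 1 + y <> 0.
Proof.
intros H. replace (1 + y) with (1 - - y) by ring.
apply one_minus_neq0. now rewrite Cmod_opp.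
Qed.

Lemma pow_S_le (r : R) (n : nat) : (0 <= r <= 1)%R -> (r ^ S n <= r)%R.
Proof.
intros Hr. rewrite <- (Rmult_1_r r) at 2. simpl.
apply Rmult_le_compat_l; [lra|]. rewrite <- (pow1 n). apply pow_incr. lra.
Qed.

Lemma Cmod_pow_S_le (q : C) (n : nat) :
  (Cmod q < 1)%R -> (Cmod (q ^ S n) <= Cmod q)%R.
Proof.
intros Hq. rewrite Cmod_pow. apply pow_S_le.
split; [apply Cmod_ge_0|lra].
Qed.

Lemma Cmod_pow_S_lt1 (q : C) (n : nat) :
  (Cmod q < 1)%R -> (Cmod (q ^ S n) < 1)%R.
Proof.
intros Hq. apply Rle_lt_trans with (2 := Hq). now apply Cmod_pow_S_le.
Qed.

Lemma qpoch_neq0 (q : C) (n : nat) : (Cmod q < 1)%R -> qpoch q q n <> 0.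
Proof.
intros Hq. induction n as [|n IH]; simpl.
- apply C1_nz.
- apply Cmult_neq_0; [exact IH|]. apply one_minus_neq0.
  now apply (Cmod_pow_S_lt1 q n).
Qed.

(** The ratio of consecutive terms is [r / Cmod (1 - q ^ S m)], which tends to [r]. This gives both
    absolute convergence of Euler's series and the factor [g] in the interchange. *)
Lemma ex_series_pow_qpoch (q : C) (r : R) :
  (Cmod q < 1)%R -> (0 <= r < 1)%R ->
  ex_series (fun m => r ^ m / Cmod (qpoch q q m))%R.
Proof.
intros Hq Hr.
assert (Hpos : forall m, (0 < Cmod (qpoch q q m))%R).
{ intros m. apply Cmod_gt_0. now apply qpoch_neq0. }
assert (Hfac : forall m, (0 < Cmod (1 - q * q ^ m))%R).
{ intros m. apply Cmod_gt_0, one_minus_neq0. now apply (Cmod_pow_S_lt1 q m). }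
(* A positive ratio is needed for d'Alembert's test. *)
set (r' := ((1 + r) / 2)%R).
assert (Hr' : (0 < r' < 1)%R) by (unfold r'; lra).
apply (ex_series_le (K := R_AbsRing) (V := R_CompleteNormedModule) _
        (fun m => r' ^ m / Cmod (qpoch q q m))%R).
{ intros m. change (Rabs (r ^ m / Cmod (qpoch q q m)) <= r' ^ m / Cmod (qpoch q q m))%R.
  rewrite Rabs_pos_eq.
  - apply Rmult_le_compat_r; [apply Rlt_le, Rinv_0_lt_compat, Hpos|].
    apply pow_incr. unfold r'; lra.
  - apply Rmult_le_pos; [apply pow_le; lra|apply Rlt_le, Rinv_0_lt_compat, Hpos]. }
apply ex_series_ratio with (k := r') (c := fun m => (r' / Cmod (1 - q * q ^ m))%R).
- lra.
- intros m. apply Rdiv_lt_0_compat; [apply pow_lt; lra|apply Hpos].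
- intros m. simpl. rewrite Cmod_mult. field.
  split; apply Rgt_not_eq; [apply Hfac|apply Hpos].
- replace (Finite r') with (Finite (r' / 1)) by (f_equal; field).
  apply is_lim_seq_div'; [apply is_lim_seq_const| |lra].
  assert (Hg : is_lim_seq (fun m => Cmod q ^ S m)%R 0).
  { apply is_lim_seq_incr_1 with (u := fun m => (Cmod q ^ m)%R).
    apply is_lim_seq_geom. rewrite Rabs_pos_eq; [exact Hq|apply Cmod_ge_0]. }
  (* By the triangle inequality, [Cmod (1 - q ^ S m)] lies within [Cmod q ^ S m] of 1. *)
  apply (is_lim_seq_le_le (fun m => 1 - Cmod q ^ S m)%R _ (fun m => 1 + Cmod q ^ S m)%R).
  + intros m. rewrite <- Cmod_pow. change (q * q ^ m) with (q ^ S m). split.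
    * assert (H := Cmod_triangle (1 - q ^ S m) (q ^ S m)).
      replace (1 - q ^ S m + q ^ S m) with (RtoC 1) in H by ring.
      rewrite Cmod_1 in H. lra.
    * assert (H := Cmod_triangle 1 (- q ^ S m)).
      rewrite Cmod_1, Cmod_opp in H. exact H.
  + replace (Finite 1) with (Finite (1 - 0)) by (f_equal; ring).
    apply is_lim_seq_minus'; [apply is_lim_seq_const|exact Hg].
  + replace (Finite 1) with (Finite (1 + 0)) by (f_equal; ring).
    apply is_lim_seq_plus'; [apply is_lim_seq_const|exact Hg].
Qed.

(** * Euler's identity *)

Lemma Cmod_pow_qpoch (q x : C) (m : nat) : (Cmod q < 1)%R ->
  Cmod (x ^ m / qpoch q q m) = (Cmod x ^ m / Cmod (qpoch q q m))%R.
Proof.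
intros Hq. rewrite Cmod_div by now apply qpoch_neq0. now rewrite Cmod_pow.
Qed.

(** Since [1 - q ^ S m] is the last factor of [qpoch q q (S m)], multiplying the terms by
    [1 - q ^ m] yields the series multiplied by [x] and moved one index up. Subtracting it from the
    original leaves [x ^ m * q ^ m]. *)
Lemma euler_series_step (q x s : C) : (Cmod q < 1)%R ->
  Cseries (fun m => x ^ m / qpoch q q m) s ->
  Cseries (fun m => (x * q) ^ m / qpoch q q m) ((1 - x) * s).
Proof.
intros Hq Hs.
assert (H : Cseries (fun m => x ^ m * (1 - q ^ m) / qpoch q q m) (x * s)).
(* The added term at index 0 is zero because [1 - q ^ 0 = 0]. *)
{ replace (x * s) with (x * s + x ^ 0 * (1 - q ^ 0) / qpoch q q 0).
  - apply (Cseries_unshift (fun m => x ^ m * (1 - q ^ m) / qpoch q q m)).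
    apply Cseries_ext_eq with (3 := Cseries_scal x _ _ Hs); [|reflexivity].
    intros m. simpl. field. split; [|now apply qpoch_neq0].
    apply one_minus_neq0. now apply (Cmod_pow_S_lt1 q m).
  - simpl. field. }
apply Cseries_ext_eq with (3 := Cseries_minus _ _ _ _ Hs H); [|ring].
intros m. rewrite Cpow_mult_l. field. now apply qpoch_neq0.
Qed.

Lemma euler_series_iter (q x s : C) (n : nat) : (Cmod q < 1)%R ->
  Cseries (fun m => x ^ m / qpoch q q m) s ->
  Cseries (fun m => (x * q ^ n) ^ m / qpoch q q m) (qpoch q x n * s).
Proof.
intros Hq Hs. induction n as [|n IH].
- apply Cseries_ext_eq with (3 := Hs); [|simpl; ring].
  intros m. simpl. now rewrite Cmult_1_r.
- apply Cseries_ext_eq with (3 := euler_series_step _ _ _ Hq IH); [|simpl; ring].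
  intros m. simpl. do 2 f_equal. ring.
Qed.

(** The term at [m = 0] of the series at [x * q ^ n] is 1. Every later term carries at least one
    factor [q ^ n], so the rest is at most [Cmod q ^ n * (K - 1)], with [K] the sum of the absolute
    values at [x]. *)
Lemma euler_series_lim (q x s : C) : (Cmod q < 1)%R -> (Cmod x < 1)%R ->
  Cseries (fun m => x ^ m / qpoch q q m) s ->
  is_lim_seq (fun n => Cmod (qpoch q x n * s - 1)) 0.
Proof.
intros Hq Hx Hs.
destruct (ex_series_pow_qpoch q (Cmod x) Hq) as [K HK].
{ split; [apply Cmod_ge_0|exact Hx]. }
assert (HK1 : is_series (fun m => Cmod x ^ S m / Cmod (qpoch q q (S m)))%R (K - 1)%R).
{ apply (is_series_incr_1 (fun m => Cmod x ^ m / Cmod (qpoch q q m))%R).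
  simpl qpoch. rewrite Cmod_1.
  change (is_series (fun m => Cmod x ^ m / Cmod (qpoch q q m))%R (K - 1 + 1 / 1)%R).
  assert (E : forall a : R, (a - 1 + 1 / 1)%R = a) by (intros; field).
  rewrite E. exact HK. }
apply (is_lim_seq_le_le (fun _ => 0%R) _ (fun n => Cmod q ^ n * (K - 1))%R).
- intros n. split; [apply Cmod_ge_0|].
  apply (Cmod_series_le (fun m => (x * q ^ n) ^ S m / qpoch q q (S m))
    (fun m => Cmod q ^ n * (Cmod x ^ S m / Cmod (qpoch q q (S m))))%R).
  + intros m. rewrite Cmod_pow_qpoch by exact Hq.
    unfold Rdiv. rewrite <- Rmult_assoc. apply Rmult_le_compat_r.
    * apply Rlt_le, Rinv_0_lt_compat, Cmod_gt_0. now apply qpoch_neq0.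
    * rewrite Cmod_mult, Rpow_mult_distr, Rmult_comm.
      apply Rmult_le_compat_r; [apply pow_le, Cmod_ge_0|].
      rewrite Cmod_pow. apply pow_S_le. split; [apply pow_le, Cmod_ge_0|].
      rewrite <- (pow1 n). apply pow_incr. split; [apply Cmod_ge_0|lra].
  + apply Cseries_ext_eq with
      (3 := Cseries_shift _ _ (euler_series_iter q x s n Hq Hs)); [reflexivity|].
    simpl. field.
  + now apply (is_series_scal_l (Cmod q ^ n)%R _ (K - 1)%R).
- apply is_lim_seq_const.
- replace (Finite 0) with (Finite (0 * (K - 1))) by (f_equal; ring).
  apply is_lim_seq_mult'; [|apply is_lim_seq_const].
  apply is_lim_seq_geom. rewrite Rabs_pos_eq; [exact Hq|apply Cmod_ge_0].
Qed.

(** Here [qpoch q x n * s] tends to 1, which excludes [s = 0]; dividing by [s] shows that the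
    infinite product converges to [/ s]. *)
Lemma qpoch_inf_euler (q x s : C) : (Cmod q < 1)%R -> (Cmod x < 1)%R ->
  Cseries (fun m => x ^ m / qpoch q q m) s -> / qpoch_inf q x = s.
Proof.
intros Hq Hx Hs.
assert (Hlim := euler_series_lim q x s Hq Hx Hs).
assert (Hs0 : s <> 0).
{ intros ->.
  assert (H : is_lim_seq (fun _ => 1%R) 0).
  { apply is_lim_seq_ext with (2 := Hlim). intros n.
    replace (qpoch q x n * 0 - 1) with (- (1)) by ring. apply Cmod_m1. }
  apply is_lim_seq_unique in H. rewrite Lim_seq_const in H.
  injection H. lra. }
rewrite (qpoch_inf_unique q x (/ s)); [now field|].
apply filterlim_C_iff.
replace (Finite 0) with (Finite (0 * / Cmod s)) by (f_equal; ring).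
apply is_lim_seq_ext with (fun n => Cmod (qpoch q x n * s - 1) * / Cmod s)%R.
- intros n. rewrite <- Cmod_inv, <- Cmod_mult by exact Hs0. f_equal. now field.
- apply is_lim_seq_mult'; [exact Hlim|apply is_lim_seq_const].
Qed.

Lemma euler_identity (q x : C) : (Cmod q < 1)%R -> (Cmod x < 1)%R ->
  Cseries (fun m => x ^ m / qpoch q q m) (/ qpoch_inf q x).
Proof.
intros Hq Hx.
destruct (Cex_series_le (fun m => x ^ m / qpoch q q m)
            (fun m => Cmod x ^ m / Cmod (qpoch q q m))%R) as [s Hs].
- intros m. rewrite Cmod_pow_qpoch by exact Hq. apply Rle_refl.
- apply ex_series_pow_qpoch; [exact Hq|]. split; [apply Cmod_ge_0|exact Hx].
- now rewrite (qpoch_inf_euler q x s Hq Hx Hs).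
Qed.

(** * Shifted arguments and the telescoping sum *)

Lemma qpoch_inf_shift (q t : C) (n : nat) : (Cmod q < 1)%R -> (Cmod t < 1)%R ->
  / qpoch_inf q (t * q ^ n) = qpoch q t n * / qpoch_inf q t.
Proof.
intros Hq Ht. apply qpoch_inf_euler; [exact Hq| |].
- destruct n as [|n]; [now rewrite Cmult_1_r|].
  rewrite Cmod_mult. assert (H := Cmod_pow_S_lt1 q n Hq).
  assert (H0 := Cmod_ge_0 t). assert (H1 := Cmod_ge_0 (q ^ S n)). nra.
- apply euler_series_iter; [exact Hq|]. now apply euler_identity.
Qed.

(** By the shift formula the partial sum up to [n] is [/ qpoch_inf q t] minus
    [qpoch q t (S n) * / qpoch_inf q t], and the subtracted product tends to 1. *)
Lemma Cseries_telescope_qpoch_inf (q t : C) : (Cmod q < 1)%R -> (Cmod t < 1)%R ->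
  Cseries (fun n => t * q ^ n / qpoch_inf q (t * q ^ n)) (/ qpoch_inf q t - 1).
Proof.
intros Hq Ht. apply filterlim_C_iff.
apply is_lim_seq_ext with
  (fun n => Cmod (qpoch q t (S n) * / qpoch_inf q t - 1)).
- intros n.
  assert (E : @sum_n C_AbelianMonoid (fun n => t * q ^ n / qpoch_inf q (t * q ^ n)) n
    = / qpoch_inf q t - qpoch q t (S n) * / qpoch_inf q t).
  { induction n as [|n IH].
    - rewrite sum_O. unfold Cdiv. rewrite qpoch_inf_shift by assumption.
      simpl. ring.
    - rewrite Csum_n_S, IH. unfold Cdiv. rewrite qpoch_inf_shift by assumption.
      simpl. ring. }
  change (Cmod (qpoch q t (S n) * / qpoch_inf q t - 1)
    = Cmod (@sum_n C_AbelianMonoid (fun n => t * q ^ n / qpoch_inf q (t * q ^ n)) n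
        - (/ qpoch_inf q t - 1))).
  rewrite E, <- Cmod_opp. f_equal. ring.
- apply (is_lim_seq_incr_1 (fun n => Cmod (qpoch q t n * / qpoch_inf q t - 1))).
  apply euler_series_lim; [exact Hq|exact Ht|]. now apply euler_identity.
Qed.

(** * Geometric and arithmetic-geometric series *)

Lemma Cseries_geom (y : C) : (Cmod y < 1)%R -> Cseries (fun n => y ^ n) (/ (1 - y)).
Proof.
intros Hy.
destruct (Cex_series_le (fun n => y ^ n) (fun n => Cmod y ^ n)%R) as [s Hs].
- intros n. rewrite Cmod_pow. apply Rle_refl.
- apply ex_series_geom. rewrite Rabs_pos_eq; [exact Hy|apply Cmod_ge_0].
(* Dropping the first term and multiplying by [y] give the same series. *)
- assert (E : s - y ^ 0 = y * s).
  { exact (Cseries_unique _ _ _ (Cseries_shift _ _ Hs) (Cseries_scal y _ _ Hs)). }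
  replace (/ (1 - y)) with s; [exact Hs|].
  assert (Hy1 := one_minus_neq0 y Hy).
  replace s with ((s - y * s) / (1 - y)) by now field.
  rewrite <- E. simpl. now field.
Qed.

Lemma ex_series_arith_geom (r : R) : (0 <= r < 1)%R ->
  ex_series (fun n => INR (S n) * r ^ n)%R.
Proof.
(* The midpoint of [r] and 1 replaces [r], which may be 0, since the ratio test wants positive
   terms. *)
intros Hr. set (r' := ((1 + r) / 2)%R).
assert (Hr' : (0 < r' < 1)%R) by (unfold r'; lra).
apply (ex_series_le (K := R_AbsRing) (V := R_CompleteNormedModule) _
        (fun n => INR (S n) * r' ^ n)%R).
{ intros n. change (Rabs (INR (S n) * r ^ n) <= INR (S n) * r' ^ n)%R.
  rewrite Rabs_pos_eq.
  - apply Rmult_le_compat_l; [apply pos_INR|]. apply pow_incr. unfold r'; lra.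
  - apply Rmult_le_pos; [apply pos_INR|apply pow_le; lra]. }
assert (Hp : forall n, (0 < INR (S n))%R) by (intros n; apply lt_0_INR; lia).
apply ex_series_ratio with (k := r') (c := fun n => (r' * (1 + / INR (S n)))%R).
- lra.
- intros n. apply Rmult_lt_0_compat; [apply Hp|apply pow_lt; lra].
- intros n. rewrite (S_INR (S n)). simpl pow. field. apply Rgt_not_eq, Hp.
- replace (Finite r') with (Finite (r' * (1 + 0))) by (f_equal; ring).
  apply is_lim_seq_mult'; [apply is_lim_seq_const|].
  apply is_lim_seq_plus'; [apply is_lim_seq_const|].
  apply (is_lim_seq_incr_1 (fun n => / INR n)%R).
  apply (is_lim_seq_inv INR p_infty is_lim_seq_INR). discriminate.
Qed.

(** Let [s] be the sum of [(n + 1) * y ^ n]. Writing [n + 2] as [(n + 1) + 1] in the shifted series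
    gives [s - 1 = y * s + y / (1 - y)], so [s] is [1 / (1 - y) ^ 2]. *)
Lemma Cseries_arith_geom (y : C) : (Cmod y < 1)%R ->
  Cseries (fun n => INR (S n) * y ^ S n) (y / (1 - y) ^ 2).
Proof.
intros Hy. assert (Hy1 := one_minus_neq0 y Hy).
destruct (Cex_series_le (fun n => INR (S n) * y ^ n)
            (fun n => INR (S n) * Cmod y ^ n)%R) as [s Hs].
- intros n. rewrite Cmod_mult, Cmod_pow, Cmod_R, Rabs_pos_eq by apply pos_INR.
  apply Rle_refl.
- apply ex_series_arith_geom. split; [apply Cmod_ge_0|exact Hy].
- assert (E : s - INR 1 * y ^ 0 = y * s + y * / (1 - y)).
  { apply (Cseries_unique (fun n => INR (S (S n)) * y ^ S n)).
    - exact (Cseries_shift _ _ Hs).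
    - apply Cseries_ext_eq with (3 := Cseries_plus _ _ _ _ (Cseries_scal y _ _ Hs)
        (Cseries_scal y _ _ (Cseries_geom y Hy))); [|reflexivity].
      intros n. rewrite (S_INR (S n)), RtoC_plus. simpl Cpow. ring. }
  apply Cseries_ext_eq with (3 := Cseries_scal y _ _ Hs).
  + intros n. simpl Cpow. ring.
  + assert (E1 : (1 - y) * s = / (1 - y)).
    { transitivity (s - INR 1 * y ^ 0 + 1 - y * s); [simpl; ring|].
      rewrite E. now field. }
    replace s with ((1 - y) * s / (1 - y)) by now field.
    rewrite E1. simpl. now field.
Qed.

(** * Interchange in the double series from Euler's identity *)

(* Both sides sum [w n * x n * (e * x n) ^ m / qpoch q q m] over [n] and [m]. *)
Lemma euler_series_swap (q e : C) (w x B : nat -> C) :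
  (Cmod q < 1)%R -> Cmod e = 1%R -> (forall n, (Cmod (x n) <= Cmod q)%R) ->
  ex_series (fun n => Cmod (w n * x n)) ->
  (forall m, Cseries (fun n => w n * x n ^ S m) (B m)) ->
  exists s, Cseries (fun m => e ^ m * B m / qpoch q q m) s /\
    Cseries (fun n => w n * x n / qpoch_inf q (e * x n)) s.
Proof.
intros Hq He Hx Hw HB.
destruct (Cseries_swap (fun n m => w n * x n * ((e * x n) ^ m / qpoch q q m))
  (fun n => Cmod (w n * x n)) (fun m => Cmod q ^ m / Cmod (qpoch q q m))%R
  (fun n => w n * x n / qpoch_inf q (e * x n))
  (fun m => e ^ m * B m / qpoch q q m)) as [s [HA HB']].
(* [Cmod (e * x n) <= Cmod q] makes the bound on the [m]-th power independent of [n], as the product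
   form requires. *)
- intros n m. rewrite Cmod_mult. apply Rmult_le_compat_l; [apply Cmod_ge_0|].
  rewrite Cmod_pow_qpoch by exact Hq.
  apply Rmult_le_compat_r.
  + apply Rlt_le, Rinv_0_lt_compat, Cmod_gt_0. now apply qpoch_neq0.
  + apply pow_incr. rewrite Cmod_mult, He, Rmult_1_l.
    split; [apply Cmod_ge_0|apply Hx].
- exact Hw.
- apply ex_series_pow_qpoch; [exact Hq|]. split; [apply Cmod_ge_0|exact Hq].
- intros n. apply Cseries_scal, euler_identity; [exact Hq|].
  rewrite Cmod_mult, He, Rmult_1_l. apply Rle_lt_trans with (2 := Hq). apply Hx.
(* The factor [x n] outside Euler's series raises the exponent from [m] to [S m]. *)
- intros m.
  apply Cseries_ext_eq with (3 := Cseries_scal (e ^ m / qpoch q q m) _ _ (HB m)).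
  + intros n. rewrite Cpow_mult_l. simpl. field. now apply qpoch_neq0.
  + field. now apply qpoch_neq0.
- now exists s.
Qed.

(** Weights [n] give (b) for [e = 1] and (d) for [e = -1]: the sum over [n] is arithmetic-geometric
    in [q ^ S m]. *)
Lemma euler_series_swap_arith (q e : C) : (Cmod q < 1)%R -> Cmod e = 1%R ->
  exists s,
    Cseries (fun m => e ^ m * (q ^ S m / (1 - q ^ S m) ^ 2) / qpoch q q m) s /\
    Cseries (fun n => INR (S n) * q ^ S n / qpoch_inf q (e * q ^ S n)) s.
Proof.
intros Hq He.
apply (euler_series_swap q e (fun n => RtoC (INR (S n))) (fun n => q ^ S n)
         (fun m => q ^ S m / (1 - q ^ S m) ^ 2)); [exact Hq|exact He| | |].
- intros n. now apply Cmod_pow_S_le.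
- apply ex_series_ext with (fun n => Cmod q * (INR (S n) * Cmod q ^ n))%R.
  + intros n. rewrite Cmod_mult, Cmod_pow, Cmod_R, Rabs_pos_eq by apply pos_INR.
    simpl pow. change (Cmod q * (INR (S n) * Cmod q ^ n)
      = INR (S n) * (Cmod q * Cmod q ^ n))%R. ring.
  + apply (ex_series_scal_l (Cmod q) (fun n => INR (S n) * Cmod q ^ n)%R).
    apply ex_series_arith_geom. split; [apply Cmod_ge_0|exact Hq].
- intros m.
  apply Cseries_ext_eq with
    (3 := Cseries_arith_geom (q ^ S m) (Cmod_pow_S_lt1 q m Hq)); [|reflexivity].
  intros n. f_equal. rewrite <- !Cpow_mult_r. f_equal. lia.
Qed.

(** Odd exponents give (c) for [e = 1] and (e) for [e = -1]: with [y = q ^ S m], the odd powers of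
    [y] sum to [y / (1 - y ^ 2)]. *)
Lemma euler_series_swap_odd (q e : C) : (Cmod q < 1)%R -> Cmod e = 1%R ->
  exists s,
    Cseries (fun m => e ^ m * (q ^ S m / (1 - (q ^ S m) ^ 2)) / qpoch q q m) s /\
    Cseries (fun n => q ^ S (2 * n) / qpoch_inf q (e * q ^ S (2 * n))) s.
Proof.
intros Hq He.
destruct (euler_series_swap q e (fun _ => RtoC 1) (fun n => q ^ S (2 * n))
         (fun m => q ^ S m / (1 - (q ^ S m) ^ 2))) as [s [H1 H2]];
  [exact Hq|exact He| | | |].
- intros n. now apply Cmod_pow_S_le.
- apply (ex_series_le (K := R_AbsRing) (V := R_CompleteNormedModule) _
          (fun n => Cmod q ^ n)%R).
  + intros n. change (Rabs (Cmod (1 * q ^ S (2 * n))) <= Cmod q ^ n)%R.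
    rewrite Rabs_pos_eq by apply Cmod_ge_0. rewrite Cmult_1_l, Cmod_pow.
    (* Splitting off [n + 1] of the [2 * n + 1] factors leaves the geometric bound [Cmod q ^ n]. *)
    replace (S (2 * n)) with (n + S n)%nat by lia. rewrite pow_add.
    rewrite <- Rmult_1_r. apply Rmult_le_compat_l; [apply pow_le, Cmod_ge_0|].
    rewrite <- Cmod_pow. apply Rlt_le. now apply Cmod_pow_S_lt1.
  + apply ex_series_geom. rewrite Rabs_pos_eq; [exact Hq|apply Cmod_ge_0].
- intros m.
  assert (Hy : (Cmod ((q ^ S m) ^ 2) < 1)%R)
    by now apply (Cmod_pow_S_lt1 _ 1), Cmod_pow_S_lt1.
  apply Cseries_ext_eq with
    (3 := Cseries_scal (q ^ S m) _ _ (Cseries_geom ((q ^ S m) ^ 2) Hy));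
    [|reflexivity].
  intros n. rewrite Cmult_1_l, <- !Cpow_mult_r, <- Cpow_add_r. f_equal. lia.
- exists s. split; [exact H1|].
  apply Cseries_ext_eq with (3 := H2); [|reflexivity].
  intros n. now rewrite Cmult_1_l.
Qed.

Theorem theorem3p3 (t q : C) (ht : (Cmod t < 1)%R) (hq : (Cmod q < 1)%R) :
  (exists s : C,
     is_series_from_1
       (fun n => t * q ^ (n - 1) / qpoch_inf q (t * q ^ (n - 1))) s /\
     1 / qpoch_inf q t = 1 + s) /\
  (exists s : C,
     is_series_from_1
       (fun n => q ^ n / (qpoch q q (n - 1) * (1 - q ^ n) ^ 2)) s /\
     is_series_from_1
       (fun n => INR n * q ^ n / qpoch_inf q (q ^ n)) s) /\
  (exists s : C,
     is_series_from_1
       (fun n => q ^ n / (qpoch q q n * (1 + q ^ n))) s /\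
     is_series_from_1
       (fun n => q ^ (2 * n - 1) / qpoch_inf q (q ^ (2 * n - 1))) s) /\
  (exists s : C,
     is_series_from_1
       (fun n => (- (1)) ^ (n + 1) * q ^ n / (qpoch q q n * (1 - q ^ n))) s /\
     is_series_from_1
       (fun n => INR n * q ^ n / qpoch_inf q (- q ^ n)) s) /\
  (exists s : C,
     is_series_from_1
       (fun n => (- (1)) ^ (n + 1) * q ^ n / (qpoch q q n * (1 + q ^ n))) s /\
     is_series_from_1
       (fun n => q ^ (2 * n - 1) / qpoch_inf q (- q ^ (2 * n - 1))) s).
Proof.
assert (Hy : forall m, (Cmod (q ^ S m) < 1)%R) by (intros m; now apply Cmod_pow_S_lt1).
assert (Hm := fun m => one_minus_neq0 _ (Hy m)).
assert (Hp := fun m => one_plus_neq0 _ (Hy m)).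
assert (Hm2 : forall m, 1 - (q ^ S m) ^ 2 <> 0).
{ intros m. replace (1 - (q ^ S m) ^ 2) with ((1 - q ^ S m) * (1 + q ^ S m))
    by (simpl; ring). now apply Cmult_neq_0. }
assert (Hq0 := fun m => qpoch_neq0 q m hq).
assert (HqS : forall m, qpoch q q (S m) = qpoch q q m * (1 - q ^ S m)) by reflexivity.
assert (Hsub : forall m, (S m - 1)%nat = m) by (intros m; lia).
assert (Hodd : forall m, (2 * S m - 1)%nat = S (2 * m)) by (intros m; lia).
assert (Hsgn : forall m, (- (1)) ^ (S m + 1) = (- (1)) ^ m).
(* At [n = S m] the sign exponent [n + 1] is [m + 2], of the same parity as [m]. *)
{ intros m. rewrite Nat.add_1_r. simpl. ring. }
assert (Hneg : forall z, - (1) * z = - z) by (intros z; ring).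
unfold is_series_from_1. repeat split.
- exists (/ qpoch_inf q t - 1). split; [|unfold Cdiv; ring].
  apply Cseries_ext_eq with (3 := Cseries_telescope_qpoch_inf q t hq ht);
    [|reflexivity].
  intros n. now rewrite Hsub.
- destruct (euler_series_swap_arith q 1 hq Cmod_1) as [s [H1 H2]].
  exists s. split.
  + apply Cseries_ext_eq with (3 := H1); [|reflexivity].
    intros m. rewrite Hsub, Cpow_1_l. field. now split.
  + apply Cseries_ext_eq with (3 := H2); [|reflexivity].
    intros n. now rewrite Cmult_1_l.
- destruct (euler_series_swap_odd q 1 hq Cmod_1) as [s [H1 H2]].
  exists s. split.
  + apply Cseries_ext_eq with (3 := H1); [|reflexivity].
    (* In [1 - y ^ 2 = (1 - y) * (1 + y)] with [y = q ^ S m], the factor [1 - y] completes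
       [qpoch q q m] to [qpoch q q (S m)]. *)
    intros m. rewrite HqS, Cpow_1_l. field. repeat split; auto.
  + apply Cseries_ext_eq with (3 := H2); [|reflexivity].
    intros n. now rewrite Hodd, Cmult_1_l.
- destruct (euler_series_swap_arith q (- (1)) hq Cmod_m1) as [s [H1 H2]].
  exists s. split.
  + apply Cseries_ext_eq with (3 := H1); [|reflexivity].
    (* One of the two factors [1 - q ^ S m] is absorbed into [qpoch q q (S m)]; the other stays. *)
    intros m. rewrite HqS, Hsgn. field. repeat split; auto.
  + apply Cseries_ext_eq with (3 := H2); [|reflexivity].
    intros n. now rewrite Hneg.
- destruct (euler_series_swap_odd q (- (1)) hq Cmod_m1) as [s [H1 H2]].
  exists s. split.
  + apply Cseries_ext_eq with (3 := H1); [|reflexivity].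
    intros m. rewrite HqS, Hsgn. field. repeat split; auto.
  + apply Cseries_ext_eq with (3 := H2); [|reflexivity].
    intros n. now rewrite Hodd, Hneg.
Qed.
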